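(* Let $1\leq p<\infty$ and let $X$ be a Banach space which is not reflexive and whose dual $X^*$ is separable. Then $X^{**}=\mathcal{UM}(X^*,\mathbb{R})$; every $S\in X^{***}$ is $(\ell^s_p,\ell_p)$-summing as an operator from $X^{**}$ to $\mathbb{R}$; but no $S\in X^{***}\setminus X^*$ is $(\ell^s_p,\ell_p)$-controlled as an operator from $X^{**}=\mathcal{UM}(X^*,\mathbb{R})$ to $\mathbb{R}$.
   Context: All Banach spaces are real; $X^*$ is regarded as canonically embedded in $X^{***}$. $B_{X^*}$ is the closed unit ball of $X^*$, equipped with the weak$^*$-topology (a compact space), and $P(B_{X^*})$ is the set of regular Borel probability measures on $(B_{X^*},w^* )$. For Banach spaces $X,Y$, $\mathcal{L}(X^*,Y)$ is the Banach space of all continuous linear maps (operators) from $X^*$ to $Y$ (so $\mathcal{L}(X^*,\mathbb{R})=X^{**}$), and $\mathcal{UM}(X^*,Y)$ is the subspace of all $T\in\mathcal{L}(X^*,Y)$ such that $T|_{B_{X^*}}$ is universally strongly measurable, i.e. strongly $\mu$-measurable (a $\mu$-a.e. norm limit of a sequence of $\mu$-measurable simple functions) for every $\mu\in P(B_{X^*})$. For a norm-closed linear subspace $U\subseteq\mathcal{L}(X^*,Y)$ and a Banach space $Z$, an operator $S:U\to Z$ is $(\ell^s_p,\ell_p)$-summing if there is $K\geq 0$ such that $$\Big(\sum_{i=1}^n\|S(T_i)\|_Z^p\Big)^{1/p}\leq K\sup_{x^*\in B_{X^*}}\Big(\sum_{i=1}^n\|T_i(x^* )\|_Y^p\Big)^{1/p}$$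 for all $n\in\mathbb{N}$ and $T_1,\dots,T_n\in U$. If $U\subseteq\mathcal{UM}(X^*,Y)$, then $S:U\to Z$ is $(\ell^s_p,\ell_p)$-controlled if there exist $K\geq 0$ and $\mu\in P(B_{X^*})$ such that $\|S(T)\|_Z\leq K\big(\int_{B_{X^*}}\|T(\cdot)\|_Y^p\,d\mu\big)^{1/p}$ for every $T\in U$. Here these notions are used with $Y=Z=\mathbb{R}$ and $U=X^{**}$. *)

(* Defs.v *)
From HB Require Import structures.
From mathcomp Require Import all_boot all_order all_algebra.
From mathcomp Require Import all_classical all_reals all_analysis.
From mathcomp Require Import measurable_realfun.

Set Implicit Arguments.
Unset Strict Implicit.
Unset Printing Implicit Defensive.

Import Order.TTheory GRing.Theory Num.Theory.
Import numFieldNormedType.Exports.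

Local Open Scope classical_set_scope.
Local Open Scope ring_scope.

Section ContinuousLinear.
Context {R : realType}.
Variables V W : normedModType R.

Definition clinear_pred : {pred V -> W} :=
  fun f => `[< linear f /\ continuous f >].

Record clinear := CLinear {
  clinear_fun :> V -> W;
  clinear_prop : clinear_fun \in clinear_pred }.

HB.instance Definition _ := [isSub for clinear_fun].
HB.instance Definition _ := [Choice of clinear by <:].

Lemma clinear_is_linear (f : clinear) : linear f.
Proof. by have /asboolP[] := clinear_prop f. Qed.

Lemma clinear_continuous (f : clinear) : continuous f.
Proof. by have /asboolP[] := clinear_prop f. Qed.

HB.instance Definition _ (f : clinear) :=
  GRing.isLinear.Build R V W *:%R (clinear_fun f) (clinear_is_linear f).

Lemma clinear_submod_closed : submod_closed clinear_pred.
Proof.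
split=> [|a f g /asboolP[lf cf] /asboolP[lg cg]]; apply/asboolP; split.
- by move=> k x y; rewrite /= scaler0 addr0.
- by move=> x; exact: cvg_cst.
- move=> k x y; rewrite /=.
  have E z : (a *: f + g) z = a *: f z + g z by [].
  rewrite !E lf lg !scalerDr !scalerA [a * k]mulrC.
  by rewrite -!addrA; congr +%R; rewrite addrCA.
- by move=> x; apply: cvgD; [apply: cvgZr; exact: cf | exact: cg].
Qed.

HB.instance Definition _ :=
  GRing.isSubmodClosed.Build R (V -> W) clinear_pred clinear_submod_closed.
HB.instance Definition _ := [SubChoice_isSubLmodule of clinear by <:].

Lemma clinearP (f g : clinear) : (forall x, f x = g x) -> f = g.
Proof. by move=> fg; apply/val_inj/funext. Qed.

Definition opnorm (f : clinear) : R :=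
  sup [set `|f x| | x in [set x | `|x| <= 1]].

Lemma clinear_bounded (f : clinear) :
  exists2 M, 0 <= M & forall x, `|f x| <= M * `|x|.
Proof.
have /linear_boundedP/pinfty_ex_gt0[M M0 fM] :
  bounded_near f (nbhs (0 : V)).
  exact: (linear_bounded_continuous f).2 (@clinear_continuous f).
by exists M => //; exact: ltW.
Qed.

Lemma opnorm_has_sup (f : clinear) :
  has_sup [set `|f x| | x in [set x | `|x| <= 1]].
Proof.
split; first by exists `|f 0|, 0 => //=; rewrite normr0.
have [M M0 fM] := clinear_bounded f.
exists M => _ [x /= x1 <-]; apply: (le_trans (fM x)).
by rewrite ler_piMr.
Qed.

Lemma opnorm_ge0 (f : clinear) : 0 <= opnorm f.
Proof.
apply: le_trans (ub_le_sup (opnorm_has_sup f).2 _); last first.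
  by exists 0 => //=; rewrite normr0.
exact: normr_ge0.
Qed.

Lemma opnorm_le (f : clinear) x : `|f x| <= opnorm f * `|x|.
Proof.
have [->|x0] := eqVneq x 0; first by rewrite linear0 !normr0 mulr0.
have nx : 0 < `|x| by rewrite normr_gt0.
rewrite -ler_pdivrMr//.
have -> : `|f x| / `|x| = `|f (`|x|^-1 *: x)|.
  by rewrite linearZ/= normrZ normfV normr_id mulrC.
apply: (ub_le_sup (opnorm_has_sup f).2); exists (`|x|^-1 *: x) => //=.
by rewrite normrZ normfV normr_id mulVf// gt_eqF.
Qed.

Lemma opnorm_ub (f : clinear) M : 0 <= M ->
  (forall x, `|f x| <= M * `|x|) -> opnorm f <= M.
Proof.
move=> M0 fM; apply: ge_sup; first exact: (opnorm_has_sup f).1.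
by move=> _ [x /= x1 <-]; rewrite (le_trans (fM x))// ler_piMr.
Qed.

Lemma opnormD (f g : clinear) : opnorm (f + g) <= opnorm f + opnorm g.
Proof.
apply: opnorm_ub; first by rewrite addr_ge0 ?opnorm_ge0.
move=> x; rewrite mulrDl (le_trans (ler_normD _ _))//.
by rewrite lerD ?opnorm_le.
Qed.

Lemma opnormZ (a : R) (f : clinear) : opnorm (a *: f) = `|a| * opnorm f.
Proof.
have le b g : opnorm (b *: g) <= `|b| * opnorm g.
  apply: opnorm_ub; first by rewrite mulr_ge0 ?opnorm_ge0.
  by move=> x; rewrite normrZ -mulrA ler_wpM2l// opnorm_le.
apply/eqP; rewrite eq_le le/=.
have [->|a0] := eqVneq a 0; first by rewrite normr0 mul0r opnorm_ge0.
have := le a^-1 (a *: f); rewrite scalerA mulVf// scale1r normfV.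
by rewrite ler_pdivlMl ?normr_gt0.
Qed.

Lemma opnorm0_eq0 (f : clinear) : opnorm f = 0 -> f = 0.
Proof.
move=> f0; apply: clinearP => x; apply/normr0_eq0/eqP.
by rewrite eq_le normr_ge0 andbT -(mul0r `|x|) -f0 opnorm_le.
Qed.

HB.instance Definition _ :=
  Lmodule_isNormed.Build R clinear opnormD opnormZ opnorm0_eq0.

End ContinuousLinear.

Definition dual {R : realType} (X : normedModType R) : Type := clinear X R.

HB.instance Definition _ (R : realType) (X : normedModType R) :=
  NormedModule.on (dual X).

Section CanonicalEmbedding.
Context {R : realType}.
Variable X : normedModType R.

Lemma evaluation_subproof (x : X) :
  (fun f : dual X => f x) \in @clinear_pred R (dual X) R.
Proof.
apply/asboolP; have lin : linear (fun f : dual X => f x) by [].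
pose e : {linear dual X -> R} :=
  HB.pack (fun f : dual X => f x) (GRing.isLinear.Build _ _ _ _ _ lin).
split=> //; apply: (@bounded_linear_continuous _ _ _ e).
apply/linear_boundedP; exists `|x|; split => // r /ltW xr f.
by rewrite (le_trans (opnorm_le f x))// mulrC ler_wpM2r// opnorm_ge0.
Qed.

Definition evaluation (x : X) : dual (dual X) :=
  CLinear (evaluation_subproof x).

Definition reflexive_space : Prop := range evaluation = [set: dual (dual X)].

End CanonicalEmbedding.

Arguments evaluation {R X} x.
Arguments reflexive_space {R} X.

Definition separable (T : topologicalType) : Prop :=
  exists2 D : set T, countable D & dense D.

Section DualBall.
Context {R : realType}.
Variable X : normedModType R.

(* The coarsest topology making all evaluations f |-> f x continuous, that is,
   the one induced by the topology of pointwise convergence on X -> R. *)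
Definition weak_star : Type :=
  initial_topology ((fun f => f) : dual X -> {ptws X -> R}).

HB.instance Definition _ := Topological.on weak_star.

Definition closed_dual_ball : set weak_star :=
  [set f | `|f : dual X| <= 1].

Definition dual_ball : Type := set_type closed_dual_ball.

HB.instance Definition _ := Topological.on dual_ball.

Lemma dual_ball0_subproof : (0 : dual X) \in closed_dual_ball.
Proof. by rewrite inE /closed_dual_ball/= normr0. Qed.

HB.instance Definition _ :=
  isPointed.Build dual_ball (exist _ (0 : dual X) dual_ball0_subproof).

Definition dual_ball_val (b : dual_ball) : dual X := \val b.

Definition borel_dual_ball : Type :=
  g_sigma_algebraType (@open dual_ball).

HB.instance Definition _ := Measurable.on borel_dual_ball.

Definition regular_measure (mu : set borel_dual_ball -> \bar R) : Prop :=
  forall A, measurable A ->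
    mu A = ereal_inf [set mu U | U in
      [set U : set dual_ball | open U /\ A `<=` U]] /\
    mu A = ereal_sup [set mu K | K in
      [set K : set dual_ball | compact K /\ K `<=` A]].

End DualBall.

Section Measurability.
Context {R : realType}.
Variables (X Y : normedModType R).

(* [completed_algebra_gen mu] consists of the sets [A `|` N] with [A] Borel and
   [N] [mu]-negligible, i.e., of the [mu]-measurable sets. *)
Definition simple_function (mu : probability (borel_dual_ball X) R)
    (s : borel_dual_ball X -> Y) : Prop :=
  finite_set (range s) /\
  forall y, completed_algebra_gen mu (s @^-1` [set y]).

Definition strongly_measurable (mu : probability (borel_dual_ball X) R)
    (f : borel_dual_ball X -> Y) : Prop :=
  exists2 s : (borel_dual_ball X -> Y)^nat,
    forall n, simple_function mu (s n) &
    {ae mu, forall b, s n b @[n --> \oo] --> f b}.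

Definition universally_measurable : set (clinear (dual X) Y) :=
  [set T | forall mu : probability (borel_dual_ball X) R,
    regular_measure mu ->
    strongly_measurable mu (fun b => T (dual_ball_val b))].

End Measurability.

Arguments universally_measurable {R} X Y.

(* An operator on a subspace [U] is represented by a map on the whole of
   [clinear (dual X) Y], of which only the values on [U] matter. *)
Section Operators.
Context {R : realType}.
Variables (X Y Z : normedModType R) (p : R).
Implicit Types (U : set (clinear (dual X) Y)) (S : clinear (dual X) Y -> Z).

(* The set under [sup] is nonempty and, the [T i] being continuous, bounded;
   hence [sup] does not take its default value. *)
Definition summing U S : Prop :=
  exists2 K : R, 0 <= K &
    forall n (T : 'I_n -> clinear (dual X) Y), (forall i, U (T i)) ->
      (\sum_i `|S (T i)| `^ p) `^ p^-1 <=
      K * sup [set (\sum_i `|T i f| `^ p) `^ p^-1 |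
               f in [set f : dual X | `|f| <= 1]].

(* The integrand is nonnegative but possibly only [mu]-measurable. The library
   integral of a nonnegative function is the supremum of the integrals of the
   Borel simple functions below it, hence it coincides on [mu]-measurable
   functions with the integral for the completion of [mu]. *)
Definition controlled U S : Prop :=
  exists2 K : R, 0 <= K &
    exists2 mu : probability (borel_dual_ball X) R, regular_measure mu &
      forall T, U T ->
        (`|S T|%:E <=
         K%:E * (\int[mu]_b ((`|T (dual_ball_val b)| `^ p)%:E)) `^ p^-1)%E.

End Operators.

(* Main.v *)
From HB Require Import structures.
Require Import Defs.
From mathcomp Require Import all_boot all_order all_algebra.
From mathcomp Require Import all_classical all_reals all_analysis.
From mathcomp Require Import ring lra measurable_realfun.
Import Order.TTheory GRing.Theory Num.Theory.
Import numFieldNormedType.Exports.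

(** When [dual X] is norm separable, every norm-open subset of the dual ball is
a countable union of closed norm balls, and these are weak-star closed, being
intersections of conditions on the values at single points.  So norm-continuous
functions are weak-star Borel ([bidual_measurable]), and the bidual consists of
universally measurable functionals.

That a functional [S] on the bidual is summing is duality between finite
l_p and l_q sums: testing [S] on the combination of the [T i] whose coefficients
are the l_q-extremal vector for [S (T i)] and bounding the norm of this
combination by Hoelder's inequality at each point of the dual ball
([bidual_functional_summing]).

Finally, let [S] be controlled by [mu], and let [d] be a dense sequence in
[dual X].  Norm-one elements [T n] of the bidual that vanish at [d i] for
[i < n] tend to 0 pointwise, hence in L_p(mu) by dominated convergence, hence
[S (T n)] tends to 0.  Therefore, for each [e > 0], [S] has norm at most [e] on
the annihilator of finitely many [d i] ([controlled_small_on_annihilator]).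
Removing these finitely many constraints one at a time, each time by one step of
the Hahn-Banach argument, gives an element of [dual X] at distance at most [e]
from [S] ([near_evaluation]).  As [dual X] is closed in its bidual, [S] comes from
[dual X] ([evaluation_dual_closed]). *)

Local Open Scope classical_set_scope.
Local Open Scope ring_scope.

(** * Weak-star Borel measurability of bidual elements *)

Lemma separable_sequence (R : realType) (Y : normedModType R) :
  separable Y ->
  exists d : nat -> Y,
    forall (y : Y) (e : R), 0 < e -> exists i, `|y - d i| < e.
Proof.
move=> [D /pcard_surjP[d surjd] denseD]; exists d => y e e0.
have [|z [yz Dz]] := denseD (ball y e) _ (ball_open y e).
  by exists y; exact: ballxx.
have [i _ di] := surjd _ Dz; exists i; rewrite di.
by move: yz; rewrite -ball_normE.
Qed.

Lemma dual_ball_eval_continuous (R : realType) (X : normedModType R) (x : X) :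
  continuous (fun b : dual_ball X => dual_ball_val b x).
Proof.
have cW : continuous (fun f : weak_star X => (f : dual X) x).
  move=> f.
  apply: (@continuous_comp (weak_star X) {ptws X -> R} R
    (fun g => g) (fun g => g x)).
    exact: (@initial_continuous (dual X) {ptws X -> R} (fun g => g)).
  exact: (@proj_continuous X (fun=> R) x).
move=> b; apply: (@continuous_comp (dual_ball X) (weak_star X) R _
  (fun f : weak_star X => (f : dual X) x)); last exact: cW.
exact: (@initial_continuous _ (weak_star X) set_val).
Qed.

Lemma dual_ball_closed_ball (R : realType) (X : normedModType R)
    (g : dual X) (r : R) : 0 <= r ->
  closed [set b : dual_ball X | `|dual_ball_val b - g| <= r].
Proof.
move=> r0.
have -> : [set b : dual_ball X | `|dual_ball_val b - g| <= r] =
    \bigcap_x ((fun b : dual_ball X => dual_ball_val b x - g x) @^-1`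
      [set t : R | `|t| <= r * `|x|]).
  apply/seteqP; split => b /= br.
    move=> x _ /=; have := opnorm_le (dual_ball_val b - g) x.
    by move=> /le_trans; apply; rewrite ler_wpM2r.
  by apply: opnorm_ub => // x; exact: (br x I).
apply: closed_bigI => x _; apply: preimage_closed.
  move=> b _; apply: (@continuousB _ R _
    (fun b : dual_ball X => dual_ball_val b x) (fun=> g x)).
    exact: dual_ball_eval_continuous.
  exact: cst_continuous.
have -> : [set t : R | `|t| <= r * `|x|] =
    Num.norm @^-1` [set t | t <= r * `|x|] by [].
by apply: preimage_closed; [move=> ? _; exact: norm_continuous|exact: closed_le].
Qed.

(** [G] is the union of the closed balls with centre in a dense sequence and
radius [1 / n.+1] that it contains; each of them is weak-star closed. *)
Lemma dual_ball_norm_open_measurable (R : realType) (X : normedModType R)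
    (G : set (dual X)) : separable (dual X) -> open G ->
  measurable [set b : borel_dual_ball X | G (dual_ball_val b)].
Proof.
move=> /separable_sequence[d dd] oG.
pose B i n := [set g : dual X | `|g - d i| <= n.+1%:R^-1].
have -> : [set b : borel_dual_ball X | G (dual_ball_val b)] =
  \bigcup_i \bigcup_(n in [set n | B i n `<=` G])
    [set b : dual_ball X | `|dual_ball_val b - d i| <= n.+1%:R^-1].
  apply/seteqP; split => b; last by move=> [i _ [n BG] /= bn]; exact: BG.
  move=> Gb.
  have /nbhs_ballP[e/= e0 eG] : nbhs (dual_ball_val b) G.
    exact: open_nbhs_nbhs.
  have [n ne] : exists n : nat, n.+1%:R^-1 < e / 2.
    have e20 : 0 < e / 2 by rewrite divr_gt0.
    have [n _ /(_ n (leqnn n))/= h] := near_infty_natSinv_lt (PosNum e20).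
    by exists n.
  have [i bi] := dd (dual_ball_val b) n.+1%:R^-1 ltac:(by []).
  exists i => //; exists n; last exact: ltW.
  move=> g /= gi; apply: eG; rewrite -ball_normE/=.
  have -> : dual_ball_val b - g = (dual_ball_val b - d i) - (g - d i).
    by rewrite opprB addrA subrK.
  rewrite (le_lt_trans (ler_normB _ _))// [ltRHS]splitr ltrD//.
    exact: lt_trans ne.
  exact: le_lt_trans ne.
apply: bigcup_measurable => i _; apply: bigcup_measurable => n _.
rewrite -[X in measurable X]setCK; apply: measurableC.
apply: sub_sigma_algebra; apply: closed_openC.
by apply: dual_ball_closed_ball.
Qed.

Lemma bidual_measurable (R : realType) (X : normedModType R)
    (T : dual (dual X)) : separable (dual X) ->
  measurable_fun [set: borel_dual_ball X] (fun b => T (dual_ball_val b)).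
Proof.
move=> sep; apply: (measurability _ (RGenOpens.measurableE R)).
move=> _ [_ [a [b ->] <-]]; rewrite setTI.
apply: (@dual_ball_norm_open_measurable _ _ (T @^-1` `]a, b[)) => //.
apply: open_comp; last exact: interval_open.
by move=> ? _; exact: clinear_continuous.
Qed.

Import HBSimple.

Lemma measurable_strongly_measurable (R : realType) (X : normedModType R)
    (mu : probability (borel_dual_ball X) R) (f : borel_dual_ball X -> R) :
  measurable_fun setT f -> strongly_measurable mu f.
Proof.
move=> mf; have /measurable_EFinP mEf := mf.
have [s sf] := approximation_sfun measurableT mEf.
exists (fun n b => s n b) => [n|].
  split; first exact: fimfunP.
  move=> y; exists (s n @^-1` [set y]); first exact: measurable_funPTI.
  by exists set0; [exact: negligible_set0|rewrite setU0].
apply: aeW => b; have := sf b I.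
by move/fine_cvgP => [].
Qed.

(** * Functionals on the bidual are summing *)

(** Young's inequality for the conjugate exponents [p / (p - 1)] and [p], in a
form that makes sense also for [p = 1]. *)
Lemma young_powRB1 (R : realType) (p u v : R) : 1 <= p -> 0 <= u -> 0 <= v ->
  u `^ (p - 1) * v <= (1 - p^-1) * u `^ p + p^-1 * v `^ p.
Proof.
move=> p1 u0 v0; have [->|pn1] := eqVneq p 1.
  by rewrite subrr powRr0 invr1 subrr mul0r add0r !mul1r powRr1.
have {}p1 : 1 < p by rewrite lt_neqAle eq_sym pn1.
have p0 : 0 < p := lt_trans ltr01 p1.
have q0 : 0 < p - 1 by rewrite subr_gt0.
have h : (p / (p - 1))^-1 + p^-1 = 1.
  by rewrite invf_div mulrBl mul1r divff ?gt_eqF// subrK.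
have uE : (u `^ (p - 1)) `^ (p / (p - 1)) = u `^ p.
  by rewrite -powRrM mulrCA divff ?gt_eqF// mulr1.
have qE : (p / (p - 1))^-1 = 1 - p^-1 by apply/eqP; rewrite eq_sym subr_eq h.
have := @conjugate_powR _ (u `^ (p - 1)) v _ _ (powR_ge0 _ _) v0
  (divr_gt0 p0 q0) p0 h.
by rewrite uE qE [u `^ p * _]mulrC [v `^ p * _]mulrC.
Qed.

(** Hoelder's inequality for the functions [u `^ (p - 1)] and [v], written
without the conjugate exponent in order to include [p = 1]. *)
Lemma finite_hoelder (R : realType) (I : finType) (p : R) (u v : I -> R) :
  1 <= p -> (forall i, 0 <= u i) -> (forall i, 0 <= v i) ->
  0 < \sum_i u i `^ p ->
  \sum_i u i `^ (p - 1) * v i <=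
  ((\sum_i u i `^ p) `^ p^-1) `^ (p - 1) * (\sum_i v i `^ p) `^ p^-1.
Proof.
move=> p1 u0 v0 U0; have p0 : 0 < p := lt_le_trans ltr01 p1.
set U := \sum_i u i `^ p in U0 *; set V := \sum_i v i `^ p.
have [V0|Vn0] := eqVneq V 0.
  rewrite V0 powR0 ?invr_eq0 ?gt_eqF// mulr0 big1// => i _.
  have /eqP : V == 0 by rewrite V0.
  move/psumr_eq0P => /(_ (fun j _ => powR_ge0 _ _) i isT)/powR_eq0_eq0 ->.
  by rewrite mulr0.
have V0 : 0 < V.
  by rewrite lt_neqAle eq_sym Vn0 sumr_ge0// => i _; exact: powR_ge0.
set s := U `^ p^-1; set t := V `^ p^-1.
have s0 : 0 < s by exact: powR_gt0.
have t0 : 0 < t by exact: powR_gt0.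
have sE : s `^ p = U by rewrite -powRrM mulVf ?gt_eqF// powRr1 ?ltW.
have tE : t `^ p = V by rewrite -powRrM mulVf ?gt_eqF// powRr1 ?ltW.
clearbody s t.
have norm1 (w : I -> R) (r : R) : 0 < r -> (forall i, 0 <= w i) ->
    \sum_i w i `^ p = r `^ p -> \sum_i (w i / r) `^ p = 1.
  move=> r0 w0 wr; under eq_bigr do rewrite powRM ?invr_ge0 ?(ltW r0)//.
  rewrite -mulr_suml wr -powRM ?invr_ge0 ?(ltW r0)//.
  by rewrite divff ?gt_eqF// powR1.
suff : \sum_i (u i / s) `^ (p - 1) * (v i / t) <= 1.
  rewrite (_ : \sum_i _ = (\sum_i u i `^ (p - 1) * v i) / (s `^ (p - 1) * t)).
    by rewrite ler_pdivrMr ?mul1r// mulr_gt0// powR_gt0.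
  rewrite mulr_suml; apply: eq_bigr => i _.
  rewrite powRM ?invr_ge0 ?(ltW s0)// invfM.
  have -> : s^-1 `^ (p - 1) = (s `^ (p - 1))^-1.
    by rewrite -powR_inv1 ?(ltW s0)// powRAC powR_inv1// powR_ge0.
  by rewrite mulrACA.
apply: le_trans (_ : \sum_i ((1 - p^-1) * (u i / s) `^ p +
                             p^-1 * (v i / t) `^ p) <= _).
  apply: ler_sum => i _; apply: (young_powRB1 _ _ _ _ p1).
    exact: divr_ge0 (u0 i) (ltW s0).
  exact: divr_ge0 (v0 i) (ltW t0).
rewrite big_split/=.
have -> : \sum_i (1 - p^-1) * (u i / s) `^ p = 1 - p^-1.
  by rewrite -big_distrr/= (norm1 u s s0 u0 (esym sE)) mulr1.
have -> : \sum_i p^-1 * (v i / t) `^ p = p^-1.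
  by rewrite -big_distrr/= (norm1 v t t0 v0 (esym tE)) mulr1.
by rewrite subrK.
Qed.

Lemma bidual_functional_summing (R : realType) (p : R) (Y : normedModType R)
    (S : dual (dual Y)) n (T : 'I_n -> dual Y) : 1 <= p ->
  (\sum_i `|S (T i)| `^ p) `^ p^-1 <=
  `|S| * sup [set (\sum_i `|T i f| `^ p) `^ p^-1 |
              f in [set f : Y | `|f| <= 1]].
Proof.
move=> p1; have p0 : 0 < p := lt_le_trans ltr01 p1.
have pV0 : 0 <= p^-1 by rewrite invr_ge0 ltW.
set A := \sum_i _; set E := [set _ | _ in _].
have A0 : 0 <= A by apply: sumr_ge0 => i _; exact: powR_ge0.
have ubE : has_ubound E.
  exists ((\sum_i `|T i| `^ p) `^ p^-1) => _ [f /= f1 <-].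
  apply: ge0_ler_powR; rewrite ?nnegrE ?sumr_ge0//.
  apply: ler_sum => i _; apply: ge0_ler_powR; rewrite ?nnegrE ?(ltW p0)//.
  by apply: le_trans (opnorm_le (T i) f) _; rewrite ler_piMr// opnorm_ge0.
have E0 : 0 <= sup E.
  apply: le_trans (ub_le_sup ubE _); last by exists 0 => //=; rewrite normr0.
  exact: powR_ge0.
have [->|An0] := eqVneq A 0.
  by rewrite powR0 ?invr_eq0 ?gt_eqF// mulr_ge0.
have {An0}A0' : 0 < A by rewrite lt_neqAle eq_sym An0.
set s := A `^ p^-1.
have s0 : 0 < s by exact: powR_gt0.
have sE : s * s `^ (p - 1) = A.
  rewrite mulr_powRB1 ?(ltW s0)// -powRrM mulVf ?gt_eqF// powRr1//.
(* The coefficients for which S takes the value A on the combination g, while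
   their l_q norm is s `^ (p - 1). *)
pose a i := Num.sg (S (T i)) * `|S (T i)| `^ (p - 1).
pose g : dual Y := \sum_i a i *: T i.
have gE f : g f = \sum_i a i * T i f.
  have := linear_sum (evaluation f) (index_enum 'I_n) xpredT
    (fun i => a i *: T i).
  by move=> /= ->.
have SgE : S g = A.
  rewrite linear_sum; apply: eq_bigr => i _; rewrite linearZ.
  transitivity (a i * S (T i)) => //.
  by rewrite /a mulrAC -normrEsg mulr_powRB1.
have ag : `|g| <= s `^ (p - 1) * sup E.
  apply: ge_sup; first exact: (opnorm_has_sup g).1.
  move=> _ [f /= f1 <-]; rewrite gE.
  apply: le_trans (ler_norm_sum _ _ _) _.
  apply: (@le_trans _ _ (\sum_i `|S (T i)| `^ (p - 1) * `|T i f|)).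
    apply: ler_sum => i _; rewrite normrM ler_wpM2r// /a normrM normr_sg.
    rewrite (ger0_norm (powR_ge0 _ _)) ler_piMl ?powR_ge0//.
    by case: (_ != _).
  apply: le_trans (finite_hoelder _ _ _ _ _ p1 _ _ _) _ => //.
  by rewrite ler_wpM2l ?powR_ge0// ub_le_sup//; exists f.
have : A <= `|S| * (s `^ (p - 1) * sup E).
  rewrite -{1}SgE; apply: le_trans (ler_norm _) _.
  exact: le_trans (opnorm_le S g) (ler_wpM2l (opnorm_ge0 S) ag).
by rewrite -{1}sE mulrCA mulrC ler_pM2l// powR_gt0.
Qed.

(** * Functionals close to evaluations *)

(** The constant [c] has to separate the numbers [S f - e * `|f|] from the
numbers [S g + e * `|g|], for [f] and [g] in [M] where [y] takes the value 1.  The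
assumption applied to [f - g] says that this is possible. *)
Lemma hahn_banach_step (R : realType) (V : normedModType R) (M : set V)
    (S y : {linear V -> R}) (e : R) :
  (forall (a : R) u v, M u -> M v -> M (a *: u + v)) ->
  (forall f, M f -> y f = 0 -> `|S f| <= e * `|f|) -> 0 <= e ->
  exists c, forall f, M f -> `|S f - c * y f| <= e * `|f|.
Proof.
move=> linM kerS e0.
have MZ a f : M f -> M (a *: f).
  move=> Mf; have -> : a *: f = (a - 1) *: f + f.
    by rewrite scalerBl scale1r subrK.
  exact: linM.
pose L := [set S f - e * `|f| | f in [set f | M f /\ y f = 1]].
have LU f g : M f -> y f = 1 -> M g -> y g = 1 ->
    S f - e * `|f| <= S g + e * `|g|.
  move=> Mf yf Mg yg; have Mfg : M (f - g).
    by rewrite addrC -scaleN1r; exact: linM.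
  have := kerS _ Mfg; rewrite !linearB/= yf yg subrr => /(_ erefl).
  move=> /(le_trans (ler_norm _)) h.
  have := le_trans h (ler_wpM2l e0 (ler_normB f g)); lra.
have hit f : M f -> y f = 1 -> `|S f - sup L| <= e * `|f|.
  move=> Mf yf; have Lf : L (S f - e * `|f|) by exists f.
  have ubL : has_ubound L.
    by exists (S f + e * `|f|) => _ [g [Mg yg] <-]; exact: LU.
  have := ub_le_sup ubL Lf => lo.
  have hi : sup L <= S f + e * `|f|.
    apply: ge_sup; first by exists (S f - e * `|f|).
    by move=> _ [g [Mg yg] <-]; exact: LU.
  rewrite ler_norml; apply/andP; split; lra.
(* If no element of M has y f = 1, then y vanishes on M and the default value of
   the supremum is harmless. *)
exists (sup L) => f Mf; have [yf0|yf0] := eqVneq (y f) 0.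
  by rewrite yf0 mulr0 subr0; exact: kerS.
have yf1 : y ((y f)^-1 *: f) = 1 by rewrite linearZ; exact: mulVf.
have {yf1} := hit _ (MZ _ _ Mf) yf1.
have -> : S ((y f)^-1 *: f) - sup L = (y f)^-1 * (S f - sup L * y f).
  rewrite linearZ mulrBr mulrCA mulVf// mulr1; congr (_ - _).
rewrite normrM normrZ normfV mulrCA.
by rewrite ler_pM2l// invr_gt0 normr_gt0.
Qed.

(** Dually to extending [S] from the annihilator of [d 0, ..., d (k - 1)], each
step subtracts from [S] a multiple of the evaluation at one [d i], and the
remainder is bounded by [e] under one constraint less. *)
Lemma near_evaluation (R : realType) (Y : normedModType R) (d : nat -> Y)
    (e : R) (k : nat) (S : {linear dual Y -> R}) : 0 <= e ->
  (forall f : dual Y, (forall i, (i < k)%N -> f (d i) = 0) ->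
    `|S f| <= e * `|f|) ->
  exists y : Y, forall f : dual Y, `|S f - f y| <= e * `|f|.
Proof.
move=> e0; elim: k S => [|k IH] S kerS.
  by exists 0 => f; rewrite linear0 subr0; exact: kerS.
have [|f Mf fk|//|c Sc] := @hahn_banach_step R (dual Y)
    [set f | forall i, (i < k)%N -> f (d i) = 0] S (evaluation (d k)) e.
- move=> a u v Mu Mv i ik.
  have -> : (a *: u + v) (d i) = a *: u (d i) + v (d i) by [].
  by rewrite Mu// Mv// scaler0 addr0.
- by apply: kerS => i; rewrite ltnS leq_eqVlt => /predU1P[->|]; [|exact: Mf].
have linS' : linear (fun f : dual Y => S f - c * f (d k)).
  move=> a u v; rewrite linearP.
  have E : (a *: u + v : dual Y) (d k) = a * u (d k) + v (d k) by [].
  move: E => ->.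
  rewrite /GRing.scale/=; ring.
pose S' : {linear dual Y -> R} :=
  HB.pack (fun f : dual Y => S f - c * f (d k))
    (GRing.isLinear.Build _ _ _ _ _ linS').
have [y Sy] := IH S' Sc.
exists (c *: d k + y) => f; rewrite linearP/=; have := Sy f; rewrite /S'/=.
by rewrite opprD addrA.
Qed.

(** An [S] that comes from [dual X] can only come from its restriction to [X], the
functional [x |-> S (evaluation x)].  Since norms in [dual X] are computed on
[X], an element of [dual X] at distance at most [e] from [S] is also at distance
at most [e] from this restriction. *)
Lemma evaluation_dual_closed (R : realType) (X : normedModType R)
    (S : dual (dual (dual X))) :
  (forall e : R, 0 < e -> exists y : dual X, forall f : dual (dual X),
    `|S f - f y| <= e * `|f|) -> range evaluation S.
Proof.
move=> Sy.
have ev_le (x : X) : `|evaluation x : dual (dual X)| <= `|x|.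
  apply: opnorm_ub => // f; rewrite mulrC; exact: (opnorm_le f x).
have lin : linear (fun x : X => S (evaluation x)).
  move=> a u v; rewrite -linearP; congr (S _); apply: clinearP => f.
  exact: linearP.
pose g : {linear X -> R} :=
  HB.pack (fun x : X => S (evaluation x)) (GRing.isLinear.Build _ _ _ _ _ lin).
have gP : (g : X -> R) \in @clinear_pred R X R.
  apply/asboolP; split; first exact: lin.
  apply: bounded_linear_continuous; apply/linear_boundedP.
  exists `|S|; split => // r /ltW Sr x; rewrite (le_trans (opnorm_le S _))//.
  by apply: ler_pM; [exact: opnorm_ge0|exact: normr_ge0|exact: Sr|exact: ev_le].
pose y0 : dual X := CLinear gP.
exists y0 => //; apply: clinearP => f.
apply/esym/eqP; rewrite -subr_eq0 -normr_le0.
apply/ler_addgt0Pl => _ /posnumP[e].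
pose a := e%:num / (`|f| *+ 2 + 1).
have n0 : 0 < `|f| *+ 2 + 1 by rewrite ltr_wpDl// mulrn_wge0.
have a0 : 0 < a by rewrite divr_gt0.
have [y Sya] := Sy _ a0.
have yy0 : `|y - y0| <= a.
  apply: opnorm_ub => [|x]; first exact: ltW.
  have -> : (y - y0) x = y x - S (evaluation x) by [].
  rewrite distrC (le_trans (Sya _))// ler_wpM2l ?(ltW a0)//.
rewrite addr0.
have -> : S f - evaluation y0 f = (S f - f y) + f (y - y0).
  by rewrite linearB/= addrA subrK.
rewrite (le_trans (ler_normD _ _))//.
apply: (@le_trans _ _ (a * `|f| + `|f| * a)).
  apply: lerD; first exact: Sya.
  exact: le_trans (opnorm_le f _) (ler_wpM2l (opnorm_ge0 f) yy0).
rewrite [_ * a]mulrC -mulr2n -mulrnAr /a mulrAC -mulrA.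
rewrite ger_pMr// ler_pdivrMr// mul1r.
by rewrite lerDl.
Qed.

(** * Controlled functionals *)

(** Equicontinuity: [f n y] is within [`|y - d i|] of [f n (d i)], which is 0
for large [n]. *)
Lemma cvg0_dense (R : realType) (Y : normedModType R) (d : nat -> Y)
    (f : nat -> dual Y) :
  (forall (y : Y) (e : R), 0 < e -> exists i, `|y - d i| < e) ->
  (forall n, `|f n| <= 1) ->
  (forall n i, (i < n)%N -> f n (d i) = 0) ->
  forall y, f n y @[n --> \oo] --> (0 : R).
Proof.
move=> dd f1 f0 y; apply/cvgrPdist_lt => e e0.
have [i yi] := dd y e e0.
near=> n; rewrite sub0r normrN.
have -> : f n y = f n (y - d i).
  by rewrite linearB/= (f0 n i) ?subr0//; near: n; exact: nbhs_infty_gt.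
apply: le_lt_trans yi; apply: le_trans (opnorm_le (f n) _) _.
by rewrite ler_piMl//; exact: f1.
Unshelve. all: by end_near. Qed.

(** Dominated convergence, with dominating function 1. *)
Lemma controlling_integral_cvg0 (R : realType) (p : R) (X : normedModType R)
    (mu : probability (borel_dual_ball X) R) (T : nat -> dual (dual X)) :
  1 <= p -> separable (dual X) -> (forall n, `|T n| <= 1) ->
  (forall g, T n g @[n --> \oo] --> (0 : R)) ->
  (\int[mu]_b ((`|T n (dual_ball_val b)| `^ p)%:E))%E @[n --> \oo] --> 0%E.
Proof.
move=> p1 sep T1 T0; have p0 : 0 < p := lt_le_trans ltr01 p1.
have ball1 (b : borel_dual_ball X) n : `|T n (dual_ball_val b)| <= 1.
  have b1 : `|dual_ball_val b| <= 1 by have := set_valP b.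
  apply: le_trans (opnorm_le _ _) _.
  by apply: mulr_ile1 => //; [exact: opnorm_ge0|exact: T1].
have powle (t : R) : 0 <= t <= 1 -> t `^ p <= t.
  move=> /andP[t0 t1]; have [->|tn0] := eqVneq t 0.
    by rewrite powR0 ?gt_eqF.
  by apply: ge1r_powR => //; rewrite t1 andbT lt_neqAle eq_sym tn0.
have mT n : measurable_fun [set: borel_dual_ball X]
    (fun b => (`|T n (dual_ball_val b)| `^ p)%:E).
  apply/measurable_EFinP; apply: (measurableT_comp (measurable_powR p)).
  apply: measurableT_comp => //; exact: bidual_measurable.
have cvgT : {ae mu, forall b, setT b ->
    (`|T n (dual_ball_val b)| `^ p)%:E @[n --> \oo] --> (cst 0 b : \bar R)}.
  apply: aeW => b _; apply/fine_cvgP; split; first exact: nearW.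
  have Tb0 : `|T n (dual_ball_val b)| @[n --> \oo] --> (0 : R).
    by have /cvg_norm := T0 (dual_ball_val b); rewrite normr0.
  apply: (squeeze_cvgr _ (cvg_cst 0) Tb0).
  by apply: nearW => n /=; rewrite powR_ge0 powle// normr_ge0 ball1.
have Tle1 : {ae mu, forall b n, setT b ->
    (`|(`|T n (dual_ball_val b)| `^ p)%:E| <= (EFin \o cst 1%R) b)%E}.
  apply: aeW => b n _ /=; rewrite lee_fin (ger0_norm (powR_ge0 _ _)).
  by rewrite (le_trans (powle _ _))// ?normr_ge0 ball1.
have [_ _] := dominated_convergence measurableT mT (measurable_cst _) cvgT
  (finite_measure_integrable_cst mu _ measurableT) Tle1.
by rewrite integral0.
Qed.

(** Otherwise there are normalised [T n], vanishing at the first [n] terms of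
[d], with [e < `|S (T n)|]; but these [T n] converge to 0 in L_p(mu). *)
Lemma controlled_small_on_annihilator (R : realType) (p : R)
    (X : normedModType R) (S : dual (dual (dual X))) (d : nat -> dual X) :
  1 <= p -> separable (dual X) ->
  (forall (y : dual X) (e : R), 0 < e -> exists i, `|y - d i| < e) ->
  controlled p [set: dual (dual X)] S ->
  forall e : R, 0 < e -> exists k, forall T : dual (dual X),
    (forall i, (i < k)%N -> T (d i) = 0) -> `|S T| <= e * `|T|.
Proof.
move=> p1 sep dd [K K0 [mu _ SK]] e e0; apply: contrapT => /forallNP bad.
have p0 : 0 < p := lt_le_trans ltr01 p1.
have /choice[T TP] : forall n, exists T : dual (dual X),
    [/\ `|T| <= 1, forall i, (i < n)%N -> T (d i) = 0 & e < `|S T|].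
  move=> n; have /existsNP[T /not_implyP[T0 /negP]] := bad n.
  rewrite -ltNge => ST.
  have Tn0 : 0 < `|T|.
    rewrite normr_gt0; apply: contraTneq ST => ->.
    by rewrite linear0 !normr0 mulr0 ltxx.
  exists (`|T|^-1 *: T); split.
  - by rewrite normrZ normfV normr_id mulVf ?gt_eqF.
  - move=> i ik.
    by transitivity (`|T|^-1 * T (d i)); rewrite // T0// mulr0.
  - rewrite linearZ normrZ normfV normr_id.
    by rewrite mulrC ltr_pdivlMr.
have I0 :
    (\int[mu]_b ((`|T n (dual_ball_val b)| `^ p)%:E))%E @[n --> \oo] --> 0%E.
  apply: controlling_integral_cvg0 => // [n|]; first by have [] := TP n.
  apply: cvg0_dense dd _ _ => n; by have [] := TP n.
(* An integral below c makes the controlling bound at most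
   K * (e / (K + 1)) <= e; K + 1 is used because K may be 0. *)
pose c := (e / (K + 1)) `^ p.
have K1 : 0 < K + 1 by rewrite ltr_wpDl.
have c0 : 0 < c by rewrite powR_gt0// divr_gt0.
have /fine_cvgP[If /cvgrPdist_lt/(_ _ c0) Ic] := I0.
have [n [/= In Icn]] := @filter_ex _ _ _ _ (filterI If Ic).
have [_ _] := TP n; apply/negP; rewrite -leNgt -lee_fin.
apply: le_trans (SK (T n) I) _.
set J := (\int[mu]_b _)%E in In Icn *.
have J0 : (0 <= J)%E by apply: integral_ge0 => b _; rewrite lee_fin powR_ge0.
have Jc : fine J <= c.
  by move: Icn; rewrite sub0r normrN ger0_norm ?fine_ge0// => /ltW.
rewrite -(fineK In) poweR_EFin -EFinM lee_fin.
have : fine J `^ p^-1 <= e / (K + 1).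
  have -> : e / (K + 1) = c `^ p^-1.
    by rewrite /c -powRrM mulfV ?gt_eqF// powRr1// divr_ge0// ltW.
  by apply: ge0_ler_powR => //; rewrite ?nnegrE ?fine_ge0 ?invr_ge0// ltW.
move=> /(ler_wpM2l K0) /le_trans; apply.
by rewrite mulrA ler_pdivrMr// mulrC ler_pM2l// lerDl.
Qed.

Theorem mainTheorem2 (R : realType) (p : R) (X : completeNormedModType R)
    (hp : 1 <= p) (hrefl : ~ reflexive_space X)
    (hsep : separable (dual X)) :
  [/\ [set: dual (dual X)] = universally_measurable X R,
      forall S : dual (dual (dual X)),
        summing p [set: dual (dual X)] S &
      forall S : dual (dual (dual X)),
        ~ range evaluation S ->
        ~ controlled p (universally_measurable X R) S].
Proof.
have UM : [set: dual (dual X)] = universally_measurable X R.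
  apply/seteqP; split => // T _ mu _.
  apply: measurable_strongly_measurable; exact: bidual_measurable.
split=> // S.
  exists `|S|; first exact: normr_ge0.
  by move=> n T _; exact: bidual_functional_summing.
move=> nS; rewrite -UM => ctrl; apply: nS.
apply: evaluation_dual_closed => e e0.
have [d dd] := separable_sequence _ _ hsep.
have [k Sk] := controlled_small_on_annihilator _ _ _ _ _ hp hsep dd ctrl _ e0.
exact: near_evaluation (ltW e0) Sk.
Qed.
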